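(* Let $N$ be an abelian normal subgroup of a finite group $G$ such that $G/N$ is nilpotent. Then an automorphism $\phi$ of $G/N$ lifts to an automorphism of $G$ centralizing $N$ if and only if the restriction of $\phi$ to each Sylow subgroup $P/N$ of $G/N$ lifts to an automorphism of $P$ centralizing $N$.
   Context: For a subgroup $P$ with $N\le P\le G$ and an automorphism $\phi$ of $G/N$, ''the restriction of $\phi$ to $P/N$ lifts to an automorphism of $P$ centralizing $N$'' means that $\phi(P/N)=P/N$ and there is an automorphism $\gamma$ of $P$ with $\gamma(n)=n$ for all $n\in N$ and $\gamma(g)N=\phi(gN)$ for all $g\in P$. The case $P=G$ gives the meaning of ''$\phi$ lifts to an automorphism of $G$ centralizing $N$''. *)

(* Defs.v *)
From mathcomp Require Import all_boot all_fingroup all_solvable.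

Set Implicit Arguments.
Unset Strict Implicit.
Unset Printing Implicit Defensive.

Import GroupScope.

(* Meant for N <| G, N \subset P \subset G and phi \in Aut (G / N). An element
   of Aut P is a permutation of the whole of gT that is the identity outside P
   and restricts to an automorphism of P; similarly for phi on coset_of N. *)
Definition lifts_centralizing (gT : finGroupType) (N P : {group gT})
    (phi : {perm coset_of N}) : Prop :=
  phi @: (P / N) = P / N /\
  exists gamma : {perm gT},
    [/\ gamma \in Aut P,
        forall n, n \in N -> gamma n = n
      & forall g, g \in P -> coset N (gamma g) = phi (coset N g)].

(* Main.v *)
(* Let E be the group of pairs (g, g') in G x G with phi(gN) = g'N, M = N x N
   and D the diagonal of N x N. The graph of a lift of phi meets M in D and
   generates E together with M, so when D is normal in E lifts of phi correspond
   to complements of M / D in E / D; the same holds for a subgroup P containing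
   N and the part of E lying over P. Liftability to P forces that part to
   normalise D (its elements (g, g') then act equally on N), and E is generated
   by its Sylow subgroups, so D is normal in E. Finally an abelian normal subgroup
   has a complement as soon as it has one locally at each prime, by Gaschuetz's
   theorem. *)
Require Import Defs.
From mathcomp Require Import all_boot all_fingroup all_solvable.

Set Implicit Arguments.
Unset Strict Implicit.
Unset Printing Implicit Defensive.

Import GroupScope.

(** * Splitting over an abelian normal subgroup, prime by prime *)

Lemma splits_quotient (gT : finGroupType) (A M P : {group gT}) :
  A \subset M -> P \subset 'N(A) ->
  [splits P, over M] -> [splits P / A, over M / A].
Proof.
move=> sAM nAP /splitsP[C /complP[tiMC defP]].
apply/splitsP; exists (C / A)%G; apply/complP; split=> /=.
  by rewrite -quotientGI // tiMC quotient1.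
rewrite -quotientMl ?defP //.
by apply: subset_trans nAP; rewrite -defP mulG_subl.
Qed.

Lemma supplement_at_prime (gT : finGroupType) (p : nat) (M P X : {group gT}) :
  M <| X -> abelian M -> M \subset P -> P \subset X ->
  p^'.-nat #|X : P| -> [splits P, over M] ->
  exists K : {group gT},
    [/\ K \subset X, #|X : K| = (#|M|`_p)%N & p^'.-group (K :&: M)].
Proof.
move=> nMX abM sMP sPX p'XP splP; have [sMX _] := andP nMX.
pose A := 'O_p^'(M)%G.
have hallA: p^'.-Hall(M) A := nilpotent_pcore_Hall _ (abelian_nil abM).
have sAM : A \subset M := pcore_sub _ _.
have nAX : X \subset 'N(A).
  exact/normal_norm/(char_normal_trans (pcore_char _ _) nMX).
have oMA : #|M / A| = (#|M|`_p)%N.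
  rewrite card_quotient ?(subset_trans sMX) // -divgS // (card_Hall hallA).
  by rewrite -{1}(partnC p (cardG_gt0 M)) mulnK ?part_gt0.
have: [splits X / A, over M / A].
  rewrite (@Gaschutz_split _ _ _ (P / A)) ?quotient_normal ?quotientS //.
  - by rewrite splits_quotient ?(subset_trans sPX).
  - exact: quotient_abelian.
  rewrite oMA; apply: (@pnat_coprime p); first exact: part_pnat.
  by apply: pnat_dvd p'XP; rewrite index_quotient // subIset ?nAX.
case/splitsP=> L /complP[tiML defX].
have sLX : L \subset X / A by rewrite -defX mulG_subr.
have sAX : A <| X by rewrite /normal nAX (subset_trans sAM).
exists (coset A @*^-1 L)%G; split=> /=.
- by rewrite -(quotientGK sAX) morphpreS.
- rewrite -{1}(quotientGK sAX) index_cosetpre -oMA -divgS //= -defX TI_cardMg //.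
  by rewrite mulnK.
apply: pgroupS (pcore_pgroup p^' M).
have nAM : M \subset 'N(A) := subset_trans sMX nAX.
rewrite -quotient_sub1; last by rewrite subIset ?nAM ?orbT.
rewrite /= setIC quotientGI // cosetpreK.
by rewrite tiML.
Qed.

(* The supplements K_p obtained modulo the p'-part of M have coprime indices
   #|M|`_p, so their intersection has index #|M| and meets M trivially. *)
Lemma splits_local (gT : finGroupType) (M X : {group gT}) :
  M <| X -> abelian M ->
  (forall p, prime p -> exists P : {group gT},
     [/\ M \subset P, P \subset X, p^'.-nat #|X : P| & [splits P, over M]]) ->
  [splits X, over M].
Proof.
move=> nMX abM loc; have [sMX _] := andP nMX.
have supp (p : nat) : exists K : {group gT},
    [/\ K \subset X, #|X : K| = (#|M|`_p)%N & p^'.-group (K :&: M)].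
  have [pr_p | not_pr_p] := boolP (prime p).
    have [P [sMP sPX p'XP splP]] := loc p pr_p.
    exact: supplement_at_prime sMP sPX p'XP splP.
  (* If [p] is not prime, the p-part of [#|M|] is 1 and every group is a p'-group, so [X] itself
     serves. *)
  have p'all n : 0 < n -> p^'.-nat n.
    move=> n_gt0; apply/pnatP=> // q pr_q _; rewrite !inE.
    by apply: contraNneq not_pr_p => <-.
  by exists X; rewrite indexgg part_p'nat /pgroup ?p'all.
have suppn n : exists K : {group gT}, [/\ K \subset X,
    #|X : K| = (\prod_(p < n) (#|M|`_p))%N
    & forall p : nat, p < n -> p^'.-group (K :&: M)].
  elim: n => [|n [K [sKX iK tiK]]].
    by exists X; rewrite indexgg big_ord0.
  have [L [sLX iL tiL]] := supp n.
  (* Coprime indices force [L * K = X], which makes the index of the intersection the product of the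
     two indices. *)
  have co_LK : coprime #|X : L| #|X : K|.
    rewrite coprime_sym iK iL; elim/big_rec: _ => [|p m _ co_m]; first exact: coprime1n.
    rewrite coprimeMl co_m andbT.
    apply: (@pnat_coprime p); first exact: part_pnat.
    apply: sub_in_pnat (part_pnat n _) => q _; rewrite !inE => /eqP->.
    by rewrite neq_ltn ltn_ord orbT.
  exists (K :&: L)%G; split; first by rewrite subIset ?sKX.
    rewrite big_ord_recr /= -iK -iL -(Lagrange_index sKX (subsetIl K L)).
    by rewrite indexgI -(indexMg L K) (coprime_index_mulG sLX sKX co_LK) mulnC.
  move=> p; rewrite ltnS leq_eqVlt => /predU1P[-> | /tiK].
    by apply: pgroupS tiL; rewrite setSI ?subsetIr.
  by apply: pgroupS; rewrite setSI ?subsetIl.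
(* The bound [#|M|.+1] covers every prime divisor of [#|M|]. *)
have [K [sKX iK tiK]] := suppn #|M|.+1.
have oM : #|X : K| = #|M|.
  rewrite iK -[RHS](partnT (cardG_gt0 M)) (widen_partn _ (leqnn _)) big_mkord.
  by apply: eq_bigr => p _; rewrite p_part.
have tiMK : M :&: K = 1.
  apply/eqP; rewrite setIC trivg_card1 eqn_leq cardG_gt0 andbT leqNgt.
  apply/negP=> /pdivP[p pr_p p_dv].
  have p_small : p < #|M|.+1.
    by rewrite ltnS dvdn_leq // (dvdn_trans p_dv) // cardSg ?subsetIr.
  by have:= tiK p p_small; rewrite /pgroup p'natE ?p_dv.
apply/splitsP; exists K; apply/complP; split=> //.
apply/eqP; rewrite eqEcard mul_subG //= TI_cardMg // -oM mulnC.
by rewrite Lagrange.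
Qed.

(** * Automorphisms inducing a given one on the quotient *)

Lemma aut_stable_Sylow (gT : finGroupType) (Q S : {group gT})
    (phi : {perm gT}) :
  nilpotent Q -> Sylow Q S -> phi \in Aut Q -> phi @: S = S.
Proof.
move=> nilQ /SylowP[p _ sylS] Aphi.
have /charP[_ chS] : S \char Q.
  by rewrite (nilpotent_Hall_pcore nilQ sylS) pcore_char.
have sSQ := pHall_sub sylS.
have := chS _ (injm_autm Aphi) (im_autm Aphi).
by rewrite morphimEsub.
Qed.

(** If [h x = 1], then [phi] kills the coset of [x], so [x] lies in [N] and is fixed by [h], whence
    [x = 1]. Values of [h] are only required to lie in [G]: they fall in [P] because [phi]
    stabilises [P / N]. This serves both to restrict a lift and to build one from a graph. *)
Lemma lifts_centralizing_morph (gT : finGroupType) (G N P : {group gT})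
    (phi : {perm coset_of N}) (h : gT -> gT) :
  N <| G -> N \subset P -> P \subset G -> phi \in Aut (G / N) ->
  phi @: (P / N) = P / N ->
  {in P &, {morph h : x y / x * y}} ->
  {in N, h =1 id} ->
  (forall g, g \in P -> h g \in G /\ coset N (h g) = phi (coset N g)) ->
  lifts_centralizing P phi.
Proof.
move=> nNG sNP sPG Aphi stabP hM hN hphi; split=> //.
have nNP : N <| P := normalS sNP sPG nNG.
have phi1 : phi 1 = 1 by rewrite -(autmE Aphi) morph1.
have inP g : g \in G -> coset N g \in P / N -> g \in P.
  move=> Gg; rewrite -{2}(quotientGK nNP) => gP.
  by rewrite mem_morphpre // (subsetP (normal_norm nNG)).
pose f := Morphism hM.
have injf : 'injm f.
  apply/subsetP=> x /morphpreP[Px /set1P /= hx1].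
  apply/set1P; rewrite -hx1 hN //; apply: coset_idr.
    by rewrite (subsetP (normal_norm nNP)).
  apply: (@perm_inj _ phi); rewrite phi1 -(hphi x Px).2.
  by rewrite hx1 morph1.
have fP : f @* P = P.
  apply/morphim_fixP=> //; apply/subsetP=> _ /morphimP[x _ Px ->].
  have [Gh ch] := hphi x Px; apply: inP => //.
  by rewrite ch -stabP imset_f // mem_quotient.
exists (aut injf fP); split; first exact: Aut_aut.
  by move=> n Nn; rewrite autE ?(subsetP sNP) //= hN.
by move=> g Pg; rewrite autE //= (hphi g Pg).2.
Qed.

(** * Lifts as complements in the fibre product *)

(** The fibre product of [G] with itself over [G / N], twisted by [phi]. *)
Definition fiber_set (gT : finGroupType) (G N : {group gT})
    (phi : coset_of N -> coset_of N) : {set gT * gT} :=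
  [set x in setX G G | phi (coset N x.1) == coset N x.2].

Definition diag_set (gT : finGroupType) (N : {group gT}) : {set gT * gT} :=
  [set x in setX N N | x.1 == x.2].

Lemma group_set_diag (gT : finGroupType) (N : {group gT}) :
  group_set (diag_set N).
Proof.
apply/group_setP; split=> [|x y]; first by rewrite !inE /= group1 eqxx.
rewrite !inE => /andP[/andP[Nx1 Nx2] /eqP ex] /andP[/andP[Ny1 Ny2] /eqP ey].
by rewrite /= ex ey !groupM ?eqxx.
Qed.
Canonical diag_group gT N := Group (@group_set_diag gT N).

Lemma group_set_fiber (gT : finGroupType) (G N : {group gT})
    (phi : {perm coset_of N}) :
  N <| G -> phi \in Aut (G / N) -> group_set (fiber_set G phi).
Proof.
move=> /andP[_ nNG] Aphi; apply/group_setP; split=> [|x y].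
  by rewrite !inE /= group1 morph1 -(autmE Aphi) morph1 eqxx.
rewrite !inE => /andP[/andP[Gx1 Gx2] /eqP ex] /andP[/andP[Gy1 Gy2] /eqP ey].
rewrite /= !groupM //= !morphM ?(subsetP nNG) //= -ex -ey.
by rewrite (morphicP (Aut_morphic Aphi)) ?mem_quotient ?eqxx.
Qed.

Lemma abelian_setX (gT rT : finGroupType) (A : {group gT}) (B : {group rT}) :
  abelian A -> abelian B -> abelian (setX A B).
Proof.
move=> abA abB; apply/centsP=> -[a b] /setXP[Aa Bb] [c d] /setXP[Ac Bd].
by congr (_, _); [apply: (centsP abA) | apply: (centsP abB)].
Qed.

Lemma normal_setX_fiber (gT : finGroupType) (G N : {group gT})
    (phi : {perm coset_of N}) (E : {group gT * gT}) :
  N <| G -> phi \in Aut (G / N) -> E :=: fiber_set G phi -> setX N N <| E.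
Proof.
move=> /andP[sNG nNG] Aphi defE; apply/andP; split.
  apply/subsetP=> -[a b] /setXP[Na Nb]; rewrite defE !inE /= !(subsetP sNG) //=.
  by rewrite !coset_id // -(autmE Aphi) morph1.
apply/subsetP=> -[x y]; rewrite defE !inE /= => /andP[/andP[Gx Gy] _].
apply/subsetP=> _ /imsetP[[a b] /setXP[Na Nb] ->]; rewrite inE /=.
by rewrite !memJ_norm ?Na ?Nb // (subsetP nNG).
Qed.

(** The complement is the graph of the lift, taken modulo the diagonal. The graph normalises the
    diagonal, being a subgroup of [E] that meets the normal subgroup [setX N N] exactly there;
    [setX N N] normalises it by commutativity. *)
Lemma splits_of_lift (gT : finGroupType) (G N P : {group gT})
    (phi : {perm coset_of N}) (E : {group gT * gT}) :
  N <| G -> abelian N -> N \subset P -> P \subset G ->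
  phi \in Aut (G / N) -> E :=: fiber_set G phi ->
  lifts_centralizing P phi ->
  E :&: setX P setT \subset 'N(diag_set N) /\
  [splits (E :&: setX P setT) / diag_set N, over setX N N / diag_set N].
Proof.
move=> nNG abN sNP sPG Aphi defE [_ [gamma [Agamma gammaN gamma_phi]]].
have nNP : N <| P := normalS sNP sPG nNG.
have sDM : diag_set N \subset setX N N.
  by apply/subsetP=> x; rewrite !inE => /andP[].
have gammaP g : g \in P -> gamma g \in P.
  by move=> Pg; rewrite -{1}(autmE Agamma) -{2}(im_autm Agamma) mem_morphim.
pose Gam := [set x in setX P P | x.2 == gamma x.1].
have gGam : group_set Gam.
  apply/group_setP; split=> [|x y].
    by rewrite !inE /= group1 gammaN ?eqxx.
  rewrite !inE => /andP[/andP[Px1 Px2] /eqP ex] /andP[/andP[Py1 Py2] /eqP ey].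
  by rewrite /= !groupM //= (morphicP (Aut_morphic Agamma)) // ex ey eqxx.
have MGam : setX N N :&: Gam = diag_set N.
  apply/setP=> -[a b]; rewrite !inE /=.
  case: (boolP (a \in N)) => //= Na; case: (boolP (b \in N)) => //= Nb.
  by rewrite !(subsetP sNP) //= gammaN // eq_sym.
have sGamE : Gam \subset E.
  apply/subsetP=> -[a b]; rewrite defE !inE /= => /andP[/andP[Pa Pb] /eqP->].
  by rewrite gamma_phi // eqxx andbT !(subsetP sPG) // gammaP.
have defEP : setX N N * Gam = E :&: setX P setT.
  apply/setP=> -[a b]; apply/mulsgP/idP.
    case=> -[m n] [x y] /setXP[Nm Nn] Gxy /= [-> ->].
    have: (m, n) * (x, y) \in E.
      apply: groupM; last exact: (subsetP sGamE).
      apply: (subsetP (normal_sub (normal_setX_fiber nNG Aphi defE))).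
      exact/setXP.
    move=> Exy; rewrite inE Exy /= !inE andbT /=.
    move: Gxy; rewrite !inE /= => /andP[/andP[Px _] _].
    by rewrite groupM // (subsetP sNP).
  rewrite inE defE !inE /= => /andP[/andP[/andP[Ga Gb] /eqP eab]].
  rewrite andbT => Pa.
  have Gga : gamma a \in G by rewrite (subsetP sPG) ?gammaP.
  have nN := subsetP (normal_norm nNG).
  (* Both [b] and [gamma a] lie over [phi (coset N a)], so they differ by an element of [N]. *)
  exists (1, b * (gamma a)^-1) (a, gamma a).
  - rewrite inE /= group1 /=.
    apply: coset_idr; first by rewrite nN // groupM ?groupV.
    rewrite morphM ?morphV ?groupV ?nN //=.
    by rewrite gamma_phi // eab mulgV.
  - by rewrite !inE /= Pa gammaP ?eqxx.
  by congr (_, _); rewrite ?mul1g ?mulgKV.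
have abM : abelian (setX N N) by apply: abelian_setX.
have nDM : setX N N \subset 'N(diag_set N).
  exact: sub_abelian_norm.
have nDGam : Gam \subset 'N(diag_set N).
  rewrite -MGam; apply: normsI.
    exact: subset_trans sGamE (normal_norm (normal_setX_fiber nNG Aphi defE)).
  exact: (normG (Group gGam)).
split; first by rewrite -defEP mul_subG.
apply/splitsP; exists (Group gGam / diag_set N)%G; apply/complP; split=> /=.
  by rewrite -quotientGI // MGam trivg_quotient.
by rewrite -quotientMl // defEP.
Qed.

(** The preimage [Gam] of a complement is the graph of a function on [G]: it supplements [setX N N]
    in [E], which gives values, and meets it only in the diagonal, which makes them unique. The
    function is multiplicative since [Gam] is a group, and fixes [N] since [Gam] contains the
    diagonal. *)
Lemma lift_of_splits (gT : finGroupType) (G N : {group gT})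
    (phi : {perm coset_of N}) (E : {group gT * gT}) :
  N <| G -> phi \in Aut (G / N) -> E :=: fiber_set G phi ->
  E \subset 'N(diag_set N) ->
  [splits E / diag_set N, over setX N N / diag_set N] ->
  lifts_centralizing G phi.
Proof.
move=> nNG Aphi defE nDE /splitsP[L /complP[tiML defEL]].
have phi1 : phi 1 = 1 by rewrite -(autmE Aphi) morph1.
have phiG : phi @: (G / N) = G / N.
  by have := im_autm Aphi; rewrite morphimEdom.
have nMX := normal_setX_fiber nNG Aphi defE.
have sDM : diag_set N \subset setX N N.
  by apply/subsetP=> x; rewrite !inE => /andP[].
have nDE' : diag_set N <| E.
  by rewrite /normal nDE (subset_trans sDM (normal_sub nMX)).
pose Gam := (coset (diag_set N) @*^-1 L)%G.
have sDGam : diag_set N \subset Gam by rewrite sub_cosetpre.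
have sGamE : Gam \subset E.
  by rewrite -(quotientGK nDE') morphpreS // -defEL mulG_subr.
have tiMGam x : x \in setX N N -> x \in Gam -> x.1 = x.2.
  move=> Mx Gx; suff: x \in diag_set N by rewrite !inE => /andP[_ /eqP].
  have nDx : x \in 'N(diag_set N) by apply: (subsetP nDE); apply: (subsetP sGamE).
  apply: coset_idr => //; apply/set1gP; rewrite -tiML inE mem_quotient //=.
  by case/morphpreP: Gx.
have defEM : E \subset setX N N * Gam.
  rewrite -(mulSGid sDM) -mulgA -quotientSK // quotientMl ?cosetpreK ?defEL //.
  exact: subset_trans (normal_sub nMX) nDE.
have exG g : g \in G -> exists g', (g, g') \in Gam.
  move=> Gg; have: phi (coset N g) \in G / N.
    by rewrite -phiG imset_f // mem_quotient.
  case/morphimP=> g' _ Gg' eg'.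
  have: (g, g') \in E by rewrite defE !inE /= Gg Gg' eg' eqxx.
  move/(subsetP defEM)/mulsgP=> [[m n] [x y] /setXP[Nm Nn] Gxy [-> _]].
  (* Multiplying [(x, y)] by the diagonal element [(m, m)] stays in [Gam] and restores the first
     coordinate [g = m * x]. *)
  exists (m * y).
  have -> : (m * x, m * y) = (m, m) * (x, y) by [].
  by rewrite groupM // (subsetP sDGam) // !inE /= Nm eqxx.
have uniqG g a b : (g, a) \in Gam -> (g, b) \in Gam -> a = b.
  move=> Ga Gb; have Gab : (g, a)^-1 * (g, b) \in Gam by rewrite groupM ?groupV.
  have eab : (g, a)^-1 * (g, b) = (1, a^-1 * b) by congr (_, _); rewrite mulVg.
  rewrite eab in Gab; have := subsetP sGamE _ Gab.
  rewrite defE !inE /= group1 morph1 phi1 => /andP[Gg /eqP eN].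
  have Nab : a^-1 * b \in N.
    by apply: coset_idr => //; rewrite (subsetP (normal_norm nNG)).
  have /= := tiMGam (1, a^-1 * b); rewrite inE /= group1 Nab => /(_ isT Gab) e1.
  by rewrite -[a]mulg1 e1 mulKVg.
(* By [exG], the default 1 is never taken on [G]. *)
pose h g := odflt 1 [pick g' | (g, g') \in Gam].
have hP g : g \in G -> (g, h g) \in Gam.
  rewrite /h => /exG[g' Gg']; case: pickP => //= /(_ g').
  by rewrite Gg'.
apply: (lifts_centralizing_morph (G := G) (h := h)) => //.
- exact: normal_sub.
- move=> x y Gx Gy; apply: (uniqG (x * y)); first by rewrite hP ?groupM.
  have -> : (x * y, h x * h y) = (x, h x) * (y, h y) by [].
  by rewrite groupM ?hP.
- move=> n Nn; apply: (uniqG n).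
    by rewrite hP // (subsetP (normal_sub nNG)).
  by rewrite (subsetP sDGam) // !inE /= Nn eqxx.
move=> g Gg; have := subsetP sGamE _ (hP g Gg).
by rewrite defE !inE /= => /andP[/andP[_ Gh] /eqP].
Qed.

(** * The equivalence, via the Sylow subgroups of the fibre product *)

Theorem corollary5 (gT : finGroupType) (G N : {group gT})
    (nNG : N <| G) (abN : abelian N) (nilGN : nilpotent (G / N))
    (phi : {perm coset_of N}) (Aphi : phi \in Aut (G / N)) :
  lifts_centralizing G phi <->
  (forall P : {group gT}, N \subset P -> P \subset G ->
     Sylow (G / N) (P / N) -> lifts_centralizing P phi).
Proof.
split=> [[_ [gamma [Agamma gammaN gamma_phi]]] P sNP sPG sylP | liftP].
  apply: (lifts_centralizing_morph (h := gamma) nNG) => //.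
  - exact: aut_stable_Sylow sylP Aphi.
  - move=> x y Px Py.
    by rewrite (morphicP (Aut_morphic Agamma)) ?(subsetP sPG).
  move=> g Pg; have Gg := subsetP sPG _ Pg; rewrite gamma_phi //; split=> //.
  by rewrite -{1}(autmE Agamma) -{2}(im_autm Agamma) mem_morphim.
pose E := Group (group_set_fiber nNG Aphi).
have defE : E :=: fiber_set G phi by [].
have nME := normal_setX_fiber nNG Aphi defE.
(* As [G / N] is nilpotent, its p-core is its Sylow p-subgroup. *)
pose P p := (coset N @*^-1 'O_p(G / N))%G.
pose EP p := (E :&: setX (P p) setT)%G.
have sylO (p : nat) : p.-Sylow(G / N) 'O_p(G / N) by apply: nilpotent_pcore_Hall.
have sNP p : N \subset P p by rewrite sub_cosetpre.
have sPG p : P p \subset G by rewrite -(quotientGK nNG) morphpreS // pcore_sub.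
have liftEP p : prime p -> EP p \subset 'N(diag_set N) /\
    [splits EP p / diag_set N, over setX N N / diag_set N].
  move=> pr_p; apply: (splits_of_lift nNG abN (sNP p) (sPG p) Aphi defE).
  apply: liftP => //.
  by rewrite cosetpreK; apply/SylowP; exists p.
(* The first projection of [R], taken modulo [N], is a p-subgroup of [G / N], hence lies in its
   normal Sylow p-subgroup. *)
have sub_EP (p : nat) (R : {group gT * gT}) :
  R \subset E -> p.-group R -> R \subset EP p.
  move=> sRE pR; apply/subsetP=> x Rx; have Ex := subsetP sRE x Rx.
  rewrite inE Ex inE in_setT andbT.
  have sRG : fst @* R \subset G.
    apply/subsetP=> _ /morphimP[y _ Ry ->].
    by have := subsetP sRE y Ry; rewrite !inE => /andP[/andP[]].
  have : fst @* R / N \subset 'O_p(G / N).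
    rewrite (sub_normal_Hall (sylO p)) ?pcore_normal ?quotientS //.
    by rewrite !morphim_pgroup.
  have Rx1 : x.1 \in fst @* R by rewrite mem_morphim ?inE.
  move/subsetP/(_ _ (mem_quotient N Rx1)) => Ox1.
  by rewrite mem_morphpre // (subsetP (normal_norm nNG)) // (subsetP sRG).
(* Each Sylow subgroup of [E] lies in some [EP p], which normalises the diagonal, and together they
   generate [E]. *)
have nDE : E \subset 'N(diag_set N).
  rewrite -{1}(Sylow_gen E) gen_subG; apply/bigcupsP=> R /SylowP[p pr_p sylR].
  apply: subset_trans (sub_EP p R (pHall_sub sylR) (pHall_pgroup sylR)) _.
  exact: (liftEP p pr_p).1.
apply: (lift_of_splits nNG Aphi defE nDE).
apply: splits_local.
- exact: quotient_normal.
- exact/quotient_abelian/abelian_setX.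
move=> p pr_p; exists (EP p / diag_set N)%G; split.
- apply: quotientS; rewrite subsetI normal_sub //=.
  by apply/subsetP=> -[a b] /setXP[Na _]; rewrite in_setX in_setT (subsetP (sNP p)).
- by apply: quotientS; rewrite subsetIl.
(* [EP p] contains a Sylow p-subgroup of [E], so its index is prime to [p], and remains so modulo
   the diagonal. *)
- have [R sylR] := Sylow_exists p E.
  have p'R : p^'.-nat #|E : R| by case/and3P: sylR.
  apply: pnat_dvd p'R; apply: dvdn_trans (indexgS _ (sub_EP p R _ _)).
  - by apply: index_quotient; rewrite subIset ?nDE.
  - exact: pHall_sub sylR.
  - exact: pHall_pgroup sylR.
exact: (liftEP p pr_p).2.
Qed.
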